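(* Let $K$ be a field, $R=K[X_1,\dots,X_n]$ with $n\ge 1$, and let $\mathfrak a_\bullet$ be a graded sequence of zero-dimensional monomial ideals in $R$ supported at the origin, with corresponding sequence of asymptotic multiplier ideals $\mathfrak b_\bullet$. Then $\mathrm e(\mathfrak b_\bullet)=\operatorname{vol}(\mathfrak b_\bullet)=\operatorname{vol}(\mathfrak a_\bullet)=\mathrm e(\mathfrak a_\bullet)$.
   Context: $\mathbb N$ includes $0$. A graded sequence is a family $\{\mathfrak a_m\}_{m\in\mathbb N}$ of ideals with $\mathfrak a_p\mathfrak a_q\subseteq\mathfrak a_{p+q}$. An ideal is supported at the origin if it contains a power of $(X_1,\dots,X_n)$ (the unit ideal is allowed). For a monomial ideal $\mathfrak a$, $P_{\mathfrak a}$ is the convex hull of $\{u\in\mathbb N^n: X^u\in\mathfrak a\}$; for rational $\lambda>0$, $\mathcal I(\lambda\cdot\mathfrak a)$ is the monomial ideal generated by the $X^u$, $u\in\mathbb N^n$, with $u+(1,\dots,1)\in\operatorname{Int}(\lambda P_{\mathfrak a})$. The ideals $\mathcal I(\frac{\lambda}{p}\cdot\mathfrak a_p)$, $p\ge1$, have a unique maximal element, denoted $\mathcal I(\lambda\cdot\|\mathfrak a_\bullet\|)$. The asymptotic multiplier ideals are $\mathfrak b_m=\mathcal I(m\cdot\|\mathfrak a_\bullet\|)$, $m\ge1$. With lengths and Hilbert–Samuel multiplicities taken in the localization of $R$ at the origin ($\mathrm e(R)=0$): $\operatorname{vol}(\mathfrak a_\bullet)=\limsup_m n!\,\ell(R/\mathfrak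 a_m)/m^n$, $\mathrm e(\mathfrak a_\bullet)=\lim_m\mathrm e(\mathfrak a_m)/m^n$, and $\operatorname{vol}(\mathfrak b_\bullet)$, $\mathrm e(\mathfrak b_\bullet)$ are defined by the same formulas with $\mathfrak b_m$. *)

(* Defs.v *)
From HB Require Import structures.
From mathcomp Require Import all_boot all_order all_algebra.
From mathcomp Require mpoly.
From mathcomp Require Import all_classical all_reals all_analysis.
(* The notations of mpoly clash with those of mathcomp-analysis: below,
   [mpoly n K] is K[X_1, ..., X_n], [multinom n] is N^n and [mpolyX K u] is
   the monomial X^u. *)
Import -(notations) mpoly.

Set Implicit Arguments.
Unset Strict Implicit.
Unset Printing Implicit Defensive.

Import Order.TTheory GRing.Theory Num.Theory.
Import numFieldNormedType.Exports.

Local Open Scope classical_set_scope.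
Local Open Scope ring_scope.

Section Ideals.
Variable A : comNzRingType.
Implicit Types (I J P S : set A).

(* Unlike [idealr_closed] of ring_quotient, this allows the unit ideal. *)
Definition is_ideal I : Prop :=
  [/\ I 0, (forall x y, I x -> I y -> I (x + y))
    & (forall r x, I x -> I (r * x))].

Definition ideal_gen S : set A := smallest is_ideal S.

Definition ideal_mul I J : set A := ideal_gen [set x * y | x in I & y in J].

Fixpoint ideal_pow I (k : nat) : set A :=
  if k is k'.+1 then ideal_mul I (ideal_pow I k') else setT.

Definition prime_ideal P : Prop :=
  [/\ is_ideal P, ~ P 1 & forall x y, P (x * y) -> P x \/ P y].

Definition maximal_ideal P : Prop :=
  [/\ is_ideal P, ~ P 1
    & forall J, is_ideal J -> P `<=` J -> J = P \/ J = setT].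

(* dim A/I <= 0; the unit ideal is included. *)
Definition zero_dimensional_ideal I : Prop :=
  forall P, prime_ideal P -> I `<=` P -> maximal_ideal P.

End Ideals.

Section LengthMultiplicity.
Variables (R : realType) (A : comNzRingType).
Implicit Types I : set A.

(* The submodules of A/I are the J/I, with J an ideal containing I. *)
Definition quotient_chain I (k : nat) : Prop :=
  exists J : nat -> set A,
    [/\ J 0%N = I, J k = setT, (forall i, (i <= k)%N -> is_ideal (J i))
      & (forall i, (i < k)%N -> J i `<` J i.+1)].

Definition colength I : \bar R :=
  ereal_sup [set (k%:R)%:E | k in quotient_chain I].

(* e(I) = lim_k d! l(A/I^k) / k^d, where d is meant to be dim A.
   It is 0 for I = A. *)
Definition hs_multiplicity (d : nat) I : \bar R :=
  limn (fun k : nat =>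
    ((d`!%:R / k%:R ^+ d)%:E * colength (ideal_pow I k))%E).

End LengthMultiplicity.

Section LocalizationAtOrigin.
Variables (K : fieldType) (n : nat).

Definition regular_at_origin : {pred {fraction mpoly n K}} :=
  fun x => `[< exists f g : mpoly n K,
    meval (fun=> 0) g != 0 /\ x = tofrac f / tofrac g >].

Fact regular_at_origin_subring_closed : subring_closed regular_at_origin.
Proof.
have nz (g : mpoly n K) : meval (fun=> 0) g != 0 -> tofrac g != 0.
  by apply: contra; rewrite tofrac_eq0 => /eqP ->; rewrite meval0.
split=> [|x y|x y].
- apply/asboolP; exists 1, 1.
  by rewrite meval1 oner_eq0 tofrac1 divr1.
- move=> /asboolP[f [g [g0 ->]]] /asboolP[f' [g' [g'0 ->]]].
  apply/asboolP; exists (f * g' - f' * g), (g * g').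
  rewrite mevalM mulf_neq0 //; split=> //.
  by rewrite -mulNr addf_div ?nz // rmorphB !rmorphM /= mulNr.
- move=> /asboolP[f [g [g0 ->]]] /asboolP[f' [g' [g'0 ->]]].
  apply/asboolP; exists (f * f'), (g * g').
  rewrite mevalM mulf_neq0 //; split=> //.
  by rewrite mulf_div !rmorphM.
Qed.

HB.instance Definition _ := GRing.isSubringClosed.Build
  {fraction mpoly n K} regular_at_origin regular_at_origin_subring_closed.

(* The localization of K[X_1, ..., X_n] at (X_1, ..., X_n). *)
Record origin_local_ring := OriginLocal {
  origin_local_val :> {fraction mpoly n K} ;
  _ : origin_local_val \in regular_at_origin }.

HB.instance Definition _ := [isSub for origin_local_val].
HB.instance Definition _ := [Choice of origin_local_ring by <:].
HB.instance Definition _ :=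
  [SubChoice_isSubComNzRing of origin_local_ring by <:].

Fact tofrac_regular_at_origin (f : mpoly n K) : tofrac f \in regular_at_origin.
Proof. by apply/asboolP; exists f, 1; rewrite meval1 oner_eq0 tofrac1 divr1. Qed.

Definition origin_loc (f : mpoly n K) : origin_local_ring :=
  OriginLocal (tofrac_regular_at_origin f).

Definition local_ideal (I : set (mpoly n K)) : set origin_local_ring :=
  ideal_gen (origin_loc @` I).

End LocalizationAtOrigin.

Section MonomialIdeals.
Variables (K : fieldType) (n : nat).
Implicit Types (I : set (mpoly n K)) (a : nat -> set (mpoly n K)).

Definition monomial_span (U : set (multinom n)) : set (mpoly n K) :=
  ideal_gen [set mpolyX K u | u in U].

Definition monomial_ideal I : Prop := exists U, I = monomial_span U.

Definition origin_ideal : set (mpoly n K) :=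
  ideal_gen [set mpolyX K (mnm1 i) | i in [set: 'I_n]].

Definition supported_at_origin I : Prop :=
  is_ideal I /\ exists k, ideal_pow origin_ideal k `<=` I.

Definition graded_sequence a : Prop :=
  (forall p, is_ideal (a p)) /\
  (forall p q, ideal_mul (a p) (a q) `<=` a (p + q)%N).

End MonomialIdeals.

Section MultiplierIdeals.
Variables (R : realType) (K : fieldType) (n : nat).
Implicit Types (I : set (mpoly n K)) (a : nat -> set (mpoly n K)) (lam : rat).

Definition exponent_point (u : multinom n) : 'rV[R]_n := \row_i (u i)%:R.

Definition convex_hull (S : set 'rV[R]_n) : set 'rV[R]_n :=
  smallest (@convex_set R 'rV[R]_n) S.

Definition newton_polyhedron I : set 'rV[R]_n :=
  convex_hull [set exponent_point u | u in [set u | I (mpolyX K u)]].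

Definition multiplier_ideal lam I : set (mpoly n K) :=
  monomial_span [set u : multinom n |
    interior [set ratr lam *: x | x in newton_polyhedron I]
             (exponent_point u + const_mx 1)].

Definition multiplier_family lam a : set (set (mpoly n K)) :=
  [set multiplier_ideal (lam / p%:R) (a p) | p in [set p | (0 < p)%N]].

(* The maximal element of the family for inclusion; it exists and is unique
   for a graded sequence, so that the default value [setT] is irrelevant. *)
Definition asymptotic_multiplier_ideal lam a : set (mpoly n K) :=
  xget setT [set J | multiplier_family lam a J /\
    forall J', multiplier_family lam a J' -> J `<=` J' -> J' = J].

(* The sequence is indexed by m >= 1; the term of index 0 is never
   significant, since only limits as m tends to infinity are taken. *)
Definition asymptotic_multiplier_ideals a : nat -> set (mpoly n K) :=
  fun m => asymptotic_multiplier_ideal m%:R a.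

End MultiplierIdeals.

Section VolumeMultiplicity.
Variables (R : realType) (K : fieldType) (n : nat).
Implicit Types a : nat -> set (mpoly n K).

Definition asymptotic_volume a : \bar R :=
  limn_esup (fun m : nat =>
    ((n`!%:R / m%:R ^+ n)%:E * colength R (local_ideal (a m)))%E).

Definition multiplicity_seq a : nat -> \bar R :=
  fun m => ((m%:R ^+ n)^-1%:E * hs_multiplicity R n (local_ideal (a m)))%E.

Definition asymptotic_multiplicity a : \bar R := limn (multiplicity_seq a).

End VolumeMultiplicity.

(* Main.v *)
Require Import Defs.
From mathcomp Require Import all_boot all_order all_algebra finmap.
From mathcomp Require mpoly.
From mathcomp Require Import all_classical all_reals all_analysis.
From mathcomp Require Import zify ring lra.
Import -(notations) mpoly.
Import Order.TTheory GRing.Theory Num.Theory.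
Import numFieldNormedType.Exports.
Local Open Scope classical_set_scope.
Local Open Scope ring_scope.

(* For an up-closed set U of exponents let c(U) be the number of points of N^n
   outside U; the local colength of the monomial ideal with exponents U is c(U).
   If M V is contained in W, then c(W) <= M^n c(V), because the cells of side M
   attached to the points outside V cover the complement of W.  For the
   exponents U_m of a graded sequence this shows, as in Fekete's lemma, that
   c(U_m)/m^n is at most c(U_p)/p^n + O(1/m) for each p, hence converges to its
   infimum L: no volume is needed.  Applied to the powers of a single ideal it
   gives L <= e(a_m)/(n! m^n) <= c(U_m)/m^n, so that both sides tend to L.
   The exponents B_m of b_m contain U_m, and B_m + (2, ..., 2) lies in the set
   X_m of the y with M y in U_{Mm} for some M >= 1, because real convex
   combinations are approximated by rational ones.  By the cell argument
   c(X_m) >= L m^n, and by counting boundary points the k-th power of b_m has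
   c(k B_m) >= L (k m)^n - O((k m)^n / m), uniformly in k; so the quantities
   for b_m are squeezed to the same limit. *)

Set Implicit Arguments.
Unset Strict Implicit.

(** * Counting points outside an up-closed set *)

Definition upset (n : nat) (U : set (multinom n)) : Prop :=
  forall u v, U u -> lem u v -> U v.

(** [fset_set] of an infinite set is empty, so the count is meaningful only for a finite complement;
    hence the finiteness hypotheses below. *)
Definition cocard (n : nat) (U : set (multinom n)) : nat :=
  #|` fset_set (~` U)|.

Lemma mem_fset_set (T : choiceType) (A : set T) x :
  finite_set A -> x \in fset_set A <-> A x.
Proof. by move=> fA; rewrite in_fset_set// inE. Qed.

Lemma card_fset_set_leq_size (T T' : choiceType) (f : T -> T')
    (A : set T) (s : seq T') :
  finite_set A -> (forall x, A x -> f x \in s) ->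
  (forall x y, A x -> A y -> f x = f y -> x = y) ->
  (#|` fset_set A| <= size s)%N.
Proof.
move=> fA As inj; rewrite -(size_map f); apply: uniq_leq_size.
  rewrite map_inj_in_uniq ?fset_uniq// => x y /mem_fset_set-/(_ fA) Ax.
  by move=> /mem_fset_set-/(_ fA) Ay; exact: inj.
by move=> _ /mapP[x /mem_fset_set-/(_ fA) Ax ->]; exact: As.
Qed.

Lemma leq_card_fset_set_sub (T : choiceType) (A B : set T) :
  finite_set B -> A `<=` B -> (#|` fset_set A| <= #|` fset_set B|)%N.
Proof.
move=> fB AB; apply: fsubset_leq_card; rewrite -fset_set_sub//.
exact: sub_finite_set AB fB.
Qed.

Section Counting.
Variable n : nat.
Implicit Types (U V W : set (multinom n)) (u v w x : multinom n).

Lemma cocardS U V : finite_set (~` U) -> U `<=` V -> (cocard V <= cocard U)%N.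
Proof. by move=> fU UV; apply: leq_card_fset_set_sub => //; exact: subsetC. Qed.

(* The cells [M y + {0, ..., M - 1}^n] with [y \notin V] cover [~` W]. *)
Lemma cocard_dilate (M : nat) V W : (0 < M)%N ->
  finite_set (~` V) -> finite_set (~` W) -> upset W ->
  (forall v, V v -> W (mnm_muln v M)) ->
  (cocard W <= M ^ n * cocard V)%N.
Proof.
move=> M0 fV fW uW VW.
pose f (x : multinom n) : multinom n * {ffun 'I_n -> 'I_M} :=
  (Multinom [tuple (x i %/ M)%N | i < n],
   [ffun i => Ordinal (ltn_pmod (x i) M0)]).
pose s := [seq (v, g) | v <- fset_set (~` V), g <- enum {: {ffun 'I_n -> 'I_M}}].
have -> : (M ^ n * cocard V)%N = size s.
  by rewrite size_allpairs -cardE card_ffun !card_ord mulnC.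
apply: (@card_fset_set_leq_size _ _ f) => //.
- move=> x Wx; apply/allpairsP; exists (f x).
  split; rewrite ?mem_enum//; apply/mem_fset_set => //= Vx; apply: Wx.
  apply: uW (VW _ Vx) _.
  by apply/mnm_lepP => i; rewrite mulmnE mnmE leq_divM.
- move=> x y _ _ fxy; apply/mnmP => i.
  have := congr1 (fun z : multinom n * _ => z.1 i) fxy; rewrite /= !mnmE => d.
  have /= := congr1 (fun z : _ * {ffun 'I_n -> 'I_M} => val (z.2 i)) fxy.
  rewrite !ffunE /= => m.
  by rewrite (divn_eq (x i) M) (divn_eq (y i) M) d m.
Qed.

Definition box (B : nat) : set (multinom n) := [set x | forall i, (x i < B)%N].

Lemma finite_box B : finite_set (box B).
Proof.
pose f (g : {ffun 'I_n -> 'I_B}) := Multinom [tuple (g i : nat) | i < n].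
apply: (@sub_finite_set _ _ (range f)); last first.
  by apply: finite_image; exact: finite_finset.
move=> x xB; exists [ffun i => Ordinal (xB i)] => //.
by apply/mnmP => i; rewrite mnmE ffunE.
Qed.

End Counting.

(** A point is determined by its [i]-th coordinate, below [om], and by the remaining [n.-1]
    coordinates, each below [B]. *)
Lemma card_box_slab (n B om : nat) (i : 'I_n) :
  (#|` fset_set (@box n B `&` [set x | (x i < om)%N])| <= om * B ^ n.-1)%N.
Proof.
case: n i => [[]//|n] i.
have fA : finite_set (@box n.+1 B `&` [set x | (x i < om)%N]).
  by apply: sub_finite_set (@finite_box n.+1 B); exact: subIsetl.
pose f (x : multinom n.+1) : nat * n.-tuple nat :=
  (x i, [tuple x (lift i j) | j < n]).
pose s := [seq (k, [tuple ((g : {ffun 'I_n -> 'I_B}) j : nat) | j < n]) |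
  k <- iota 0 om, g <- enum {: {ffun 'I_n -> 'I_B}}].
have -> : (om * B ^ n)%N = size s.
  by rewrite size_allpairs -cardE card_ffun !card_ord size_iota.
apply: (@card_fset_set_leq_size _ _ f) => //.
- move=> x [xB /= xi]; apply/allpairsP.
  exists (x i, [ffun j => Ordinal (xB (lift i j))]).
  rewrite mem_iota mem_enum /=; split=> //; congr pair.
  by apply: eq_from_tnth => j; rewrite !tnth_mktuple ffunE.
- move=> x y _ _ fxy; apply/mnmP => j; case: (unliftP i j) => [k|] ->.
    by have := congr1 (fun z : nat * n.-tuple nat => tnth z.2 k) fxy;
      rewrite /= !tnth_mktuple.
  by have := congr1 (fun z : nat * n.-tuple nat => z.1) fxy.
Qed.

(** A point outside [W] either dominates [w], and subtracting [w] gives a point outside [V], or has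
    a coordinate below [om], and lies in one of [n] slabs of the box. *)
Lemma cocard_translate (n B om : nat) (V W : set (multinom n))
    (w : multinom n) :
  finite_set (~` V) -> ~` W `<=` box B -> (forall i, w i <= om)%N ->
  (forall v, V v -> W (mnm_add v w)) ->
  (cocard W <= cocard V + n * om * B ^ n.-1)%N.
Proof.
move=> fV WB wom VW.
pose slab := [fset x in
  flatten [seq fset_set (box B `&` [set x | (x i < om)%N]) : seq _
    | i <- enum 'I_n]]%fset.
have fW : finite_set (~` W) by apply: sub_finite_set (@finite_box n B).
have fs i : finite_set (box B `&` [set x : multinom n | (x i < om)%N]).
  by apply: sub_finite_set (@finite_box n B); exact: subIsetl.
pose f x := mnm_add x w.
have sub : (fset_set (~` W) `<=`
    [fset f x | x in fset_set (~` V)] `|` slab)%fset.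
  apply/fsubsetP => x /mem_fset_set-/(_ fW) Wx; apply/fsetUP.
  have [xw|] := pselect (forall i, (w i <= x i)%N).
    left; apply/imfsetP; exists (mnm_sub x w) => /=.
      apply/mem_fset_set => // /VW; rewrite submK//.
      by apply/mnm_lepP.
    by rewrite /f submK//; apply/mnm_lepP.
  move=> /existsNP[i /negP]; rewrite -ltnNge => xwi; right.
  rewrite !inE /=; apply/flatten_mapP; exists i; first by rewrite mem_enum.
  apply/mem_fset_set; first exact: fs.
  by split; [exact: WB | exact: leq_trans xwi _].
apply: leq_trans (fsubset_leq_card sub) _.
apply: leq_trans (leq_card_fsetU _ _).1 _; apply: leq_add.
  exact: leq_imfset_card.
rewrite card_fseq; apply: leq_trans (size_undup _) _.
rewrite size_flatten /shape -map_comp sumnE big_map big_enum /=.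
rewrite -mulnA -[X in (X * _)%N]card_ord -sum_nat_const.
by apply: leq_sum => i _; exact: card_box_slab.
Qed.

(** * Graded sequences of exponent sets *)

(** For up-closed [U], the exponents of the [k]-th power of the monomial ideal; the zeroth power is
    all of N^n, the unit ideal. *)
Fixpoint msumset_pow (n : nat) (U : set (multinom n)) (k : nat) :
    set (multinom n) :=
  if k is k'.+1 then
    [set mnm_add u v | u in U & v in msumset_pow U k'] else setT.

Section GradedUpsets.
Variable n : nat.
Implicit Types (B : set (multinom n)) (U : nat -> set (multinom n)).
Implicit Types (u v w x : multinom n).

Lemma lem_add_witness u v : lem u v -> v = mnm_add (mnm_sub v u) u.
Proof. by move=> uv; rewrite submK. Qed.

Lemma msumset_powS B B' k : B `<=` B' -> msumset_pow B k `<=` msumset_pow B' k.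
Proof.
move=> BB'; elim: k => [//|k IH] _ [u Bu [v Bv <-]].
by exists u; [exact: BB' | exists v => //; exact: IH].
Qed.

Lemma upset_msumset_pow B k : upset B -> upset (msumset_pow B k).
Proof.
move=> uB; case: k => [//|k] _ w [u Bu [v Bv <-]] le_w.
exists (mnm_sub w v).
  apply: (uB u) => //; apply/mnm_lepP => i; move/mnm_lepP: le_w => /(_ i).
  by rewrite mnmDE mnmBE; lia.
exists v => //; rewrite submK//; apply: lepm_trans le_w; exact: lem_addl.
Qed.

Lemma msumset_powD B j k u v : upset B ->
  msumset_pow B j u -> msumset_pow B k v -> msumset_pow B (j + k) (mnm_add u v).
Proof.
move=> uB; elim: j u => [|j IH] u /=.
  by move=> _ Bv; apply: upset_msumset_pow Bv (lem_addl _ _).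
move=> [b Bb [c Bc <-]] Bv; exists b => //; exists (mnm_add c v).
  exact: IH.
by rewrite addmA.
Qed.

Lemma msumset_pow1 B : upset B -> msumset_pow B 1 = B.
Proof.
move=> uB; apply/seteqP; split=> [_ [u Bu [v _ <-]]|u Bu].
  by apply: uB Bu (lem_addr _ _).
by exists u => //; exists (@mnm0 n) => //; rewrite addm0.
Qed.

(** The number [d], for which each X_i^d lies in a_1, controls all complements at once: that of
    [U N] with N >= 1 lies in a box of side [d * N]. *)
Definition graded_upsets (d : nat) U : Prop :=
  [/\ forall p, upset (U p),
      forall p, U p !=set0,
      forall p q u v, U p u -> U q v -> U (p + q)%N (mnm_add u v)
    & forall i, U 1%N (mnm_muln (mnm1 i) d)].

Lemma msumset_pow_nonempty B k : B !=set0 -> msumset_pow B k !=set0.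
Proof.
move=> [b Bb]; elim: k => [|k [c Bc]]; first by exists (@mnm0 n).
by exists (mnm_add b c); exists b => //; exists c.
Qed.

Lemma graded_msumset_pow d B : upset B -> B !=set0 ->
  (forall i, B (mnm_muln (mnm1 i) d)) -> graded_upsets d (msumset_pow B).
Proof.
move=> uB B0 Bd; split.
- by move=> p; exact: upset_msumset_pow.
- by move=> p; exact: msumset_pow_nonempty.
- by move=> p q u v; exact: msumset_powD.
- by rewrite msumset_pow1.
Qed.

Section Fixed.
Variables (d : nat) (U : nat -> set (multinom n)).
Hypothesis gU : graded_upsets d U.

Lemma graded_muln t q u : (0 < t)%N -> U q u -> U (t * q)%N (mnm_muln u t).
Proof.
case: gU => _ _ gD _; case: t => // t _ Uu.
elim: t => [|t IH]; first by rewrite mul1n mulm1n.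
by rewrite mulSn mulmS; exact: gD.
Qed.

Lemma graded_pow_var N i : (0 < N)%N -> U N (mnm_muln (mnm1 i) (d * N)).
Proof.
case: gU => _ _ _ gd N0; have := graded_muln N0 (gd i); rewrite muln1.
by congr (U N _); apply/mnmP => j; rewrite !mulmnE mulnA.
Qed.

Lemma graded_compl_box N : (0 < N)%N -> ~` U N `<=` box (d * N).
Proof.
move=> N0 x Ux i; rewrite ltnNge; apply/negP => dx; apply: Ux.
case: gU => gu _ _ _; apply: (gu N _ _ (graded_pow_var i N0)).
apply/mnm_lepP => j; rewrite mulmnE mnm1E; case: eqVneq => [<-|_].
  by rewrite mul1n.
by rewrite mul0n.
Qed.

Lemma graded_finite N : (0 < N)%N -> finite_set (~` U N).
Proof. by move=> /graded_compl_box /sub_finite_set; apply; exact: finite_box. Qed.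

(** [k] is positive because the zeroth power is all of N^n, while [U 0] may be smaller. *)
Lemma msumset_pow_graded m k : (0 < k)%N -> msumset_pow (U m) k `<=` U (k * m)%N.
Proof.
case: gU => gu _ gD _; case: k => // k _.
elim: k => [|k IH] _ [u Uu [v Uv <-]].
  by rewrite mul1n; apply: gu Uu (lem_addr _ _).
by rewrite mulSn; apply: gD => //; exact: IH.
Qed.

(** The sum of one point from each [U r] works. It absorbs the remainder when an index is divided by
    [p]. *)
Lemma graded_common_point p : exists w, forall r, (r < p)%N -> U r w.
Proof.
case: gU => gu g0 _ _; elim: p => [|p [w IH]]; first by exists (@mnm0 n).
have [w' Uw'] := g0 p; exists (mnm_add w w') => r.
rewrite ltnS leq_eqVlt => /orP[/eqP->|/IH rw].
  exact: gu Uw' (lem_addl _ _).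
exact: gu rw (lem_addr _ _).
Qed.

Lemma graded_pow_msumset p : (0 < p)%N ->
  graded_upsets (d * p) (msumset_pow (U p)).
Proof.
move=> p0; case: (gU) => gu g0 _ _; apply: graded_msumset_pow => // i.
exact: graded_pow_var.
Qed.

End Fixed.

(** Since [k] times a point of [B] is a [k]-fold sum, [cocard_dilate] applies. In the limit this
    bounds e(I) by n! times the colength of I. *)
Lemma cocard_msumset_pow B k d : upset B -> B !=set0 ->
  (forall i, B (mnm_muln (mnm1 i) d)) ->
  (0 < n)%N ->
  (cocard (msumset_pow B k) <= k ^ n * cocard B)%N.
Proof.
move=> uB B0 Bd n0; have gB := graded_msumset_pow uB B0 Bd.
case: k => [|k]; first by rewrite /cocard /= setCT fset_set0.
apply: cocard_dilate => //.
- by have := graded_finite gB (ltn0Sn 0); rewrite msumset_pow1.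
- exact: (graded_finite gB (ltn0Sn k)).
- exact: upset_msumset_pow.
- move=> v Bv; have := @graded_muln _ _ gB k.+1 1 v.
  by rewrite muln1 msumset_pow1//; exact.
Qed.

(* Divide [m] by [p]: [U_m] contains a translate of [(m %/ p) U_p] by an element
   lying in all the [U_r] with [r < p]. *)
Lemma graded_cocard_leq d U p : graded_upsets d U -> (0 < n)%N -> (0 < p)%N ->
  exists C, forall m, (0 < m)%N ->
  (p ^ n * cocard (U m) <= m ^ n * cocard (U p) + p ^ n * (C * m ^ n.-1))%N.
Proof.
move=> gU n0 p0; have [w Uw] := graded_common_point gU p.
have [gu g0 gD gd] := gU.
(* Each coordinate of [w] is at most [mdeg w], and the complement of [U m] lies in a box of side
   [d * m]: this is the error term of [cocard_translate]. *)
exists (n * mdeg w * d ^ n.-1)%N => m m0.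
have wom i : (w i <= mdeg w)%N.
  by rewrite mdegE (bigD1 i)//= leq_addr.
have gB := graded_pow_msumset gU p0.
have fV : finite_set (~` msumset_pow (U p) (m %/ p)).
  case: (m %/ p)%N => [|k]; first by rewrite /= setCT.
  exact: (graded_finite gB).
have := cocard_translate fV (graded_compl_box gU m0) wom.
have /[swap]/[apply] : forall v, msumset_pow (U p) (m %/ p) v ->
    U m (mnm_add v w).
  move=> v Uv; rewrite [X in U X](divn_eq m p).
  have := Uw _ (ltn_pmod m p0); move: Uv.
  case: (m %/ p)%N => [|k] Uv Umw.
    by rewrite mul0n add0n; apply: gu Umw _; exact: lem_addl.
  by apply: gD => //; exact: (msumset_pow_graded gU (ltn0Sn k) Uv).
have := cocard_msumset_pow (m %/ p) (gu p) (g0 p)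
  (fun i => graded_pow_var gU i p0) n0.
move=> le1 le2; apply: leq_trans (leq_mul (leqnn (p ^ n)) le2) _.
rewrite mulnDr leq_add//.
  apply: leq_trans (leq_mul (leqnn (p ^ n)) le1) _.
  by rewrite mulnA -expnMn leq_mul2r leq_exp2r// mulnC leq_divM orbT.
by rewrite expnMn !mulnA.
Qed.

(** For [N] positive, the integral points of N times the union over q >= 1 of the sets (1/q) U_q: a
    rational stand-in for the convex region attached to the sequence. *)
Definition saturation U (N : nat) : set (multinom n) :=
  [set y | exists2 M, (0 < M)%N & U (M * N)%N (mnm_muln y M)].

Section Saturation.
Variables (d : nat) (U : nat -> set (multinom n)).
Hypothesis gU : graded_upsets d U.

Lemma sub_saturation N : U N `<=` saturation U N.
Proof. by move=> u Uu; exists 1%N; rewrite // mul1n mulm1n. Qed.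

Lemma upset_saturation N : upset (saturation U N).
Proof.
move=> u v [M M0 UM] /mnm_lepP uv; exists M => //.
case: gU => gu _ _ _; apply: gu UM _; apply/mnm_lepP => i.
by rewrite !mulmnE leq_mul2r uv orbT.
Qed.

Lemma saturationD p q u v : saturation U p u -> saturation U q v ->
  saturation U (p + q)%N (mnm_add u v).
Proof.
move=> [M M0 UM] [M' M'0 UM']; exists (M * M')%N; first by rewrite muln_gt0 M0.
case: (gU) => _ _ gD _.
have := gD _ _ _ _ (graded_muln gU M'0 UM) (graded_muln gU M0 UM').
have -> : (M' * (M * p) + M * (M' * q) = M * M' * (p + q))%N by lia.
congr (U _ _); apply/mnmP => i.
by rewrite mnmDE !mulmnE mnmDE; lia.
Qed.

Lemma saturation_common N (s : seq (multinom n)) :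
  {in s, forall y, saturation U N y} ->
  exists2 M, (0 < M)%N & {in s, forall y, U (M * N)%N (mnm_muln y M)}.
Proof.
elim: s => [|x s IH] sX; first by exists 1%N.
have [y ys|M M0 UM] := IH; first by apply: sX; rewrite inE ys orbT.
have [M' M'0 UM'] := sX x (mem_head _ _).
exists (M * M')%N; first by rewrite muln_gt0 M0.
have mE y a b : mnm_muln y (a * b) = mnm_muln (mnm_muln y a) b.
  by apply/mnmP => i; rewrite !mulmnE mulnA.
move=> y; rewrite inE => /orP[/eqP->|/UM Uy].
  by rewrite -mulnA [X in mnm_muln x X]mulnC mE; exact: (graded_muln gU).
by rewrite mE -mulnA mulnCA; exact: (graded_muln gU).
Qed.

(** Only finitely many points of the saturation lie outside [U N], so one [M] serves them all, and
    multiplication by [M] sends the whole saturation into [U (M * N)]. *)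
Lemma cocard_saturation N : (0 < N)%N ->
  exists2 M, (0 < M)%N &
    (cocard (U (M * N)) <= M ^ n * cocard (saturation U N))%N.
Proof.
move=> N0.
have fX : finite_set (saturation U N `&` ~` U N).
  by apply: sub_finite_set (graded_finite gU N0); exact: subIsetr.
have [y|M M0 UM] := @saturation_common N (fset_set (saturation U N `&` ~` U N)).
  by move=> /mem_fset_set-/(_ fX)[].
exists M => //; apply: cocard_dilate => //.
- apply: sub_finite_set (graded_finite gU N0).
  exact/subsetC/sub_saturation.
- by apply: (graded_finite gU); rewrite muln_gt0 M0.
- by case: gU.
- move=> v Xv; have [Uv|Uv] := pselect (U N v); first exact: (graded_muln gU).
  by apply: UM; apply/mem_fset_set.
Qed.

Lemma saturation_msumset_pow B m w k : (0 < k)%N ->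
  (forall u, B u -> saturation U m (mnm_add u w)) ->
  forall u, msumset_pow B k u ->
    saturation U (k * m)%N (mnm_add u (mnm_muln w k)).
Proof.
case: k => // k _ BX; elim: k => [|k IH] _ [u Bu [v Bv <-]].
  rewrite mul1n mulm1n; apply: upset_saturation (BX _ Bu) _.
  by apply/mnm_lepP => i; rewrite !mnmDE; lia.
have := saturationD (BX _ Bu) (IH _ Bv); rewrite -mulSn.
by congr (saturation U _ _); apply/mnmP => i; rewrite !(mnmDE, mulmnE); lia.
Qed.

(** The [k]-fold sum is moved by [k] times [w]: a translation of size O(k) in a box of side
    [d * (k * m)]. After division by (k m)^n the error is O(1/m), uniformly in [k]. *)
Lemma cocard_saturation_msumset_pow B m w om k : (0 < k)%N -> (0 < m)%N ->
  (forall i, w i <= om)%N -> U m `<=` B -> upset B ->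
  (forall u, B u -> saturation U m (mnm_add u w)) ->
  (cocard (saturation U (k * m)) <=
    cocard (msumset_pow B k) + n * (om * k) * (d * (k * m)) ^ n.-1)%N.
Proof.
move=> k0 m0 wom UB uB BX; apply: (@cocard_translate _ _ _ _ _ (mnm_muln w k)).
- have gB := graded_pow_msumset gU m0.
  apply: sub_finite_set (graded_finite gB k0).
  exact/subsetC/msumset_powS.
- apply: subset_trans (graded_compl_box gU _); last by rewrite muln_gt0 k0.
  exact/subsetC/sub_saturation.
- by move=> i; rewrite mulmnE leq_mul2r wom orbT.
- exact: saturation_msumset_pow.
Qed.

End Saturation.
End GradedUpsets.

(** * Convergence of densities *)

Lemma cvg_div_nat (R : realType) (C : R) :
  (fun m : nat => C / m%:R) @ \oo --> (0 : R).
Proof.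
rewrite -cvg_shiftS /=.
have : (fun m => C * harmonic m) @ \oo --> C * 0.
  by apply: cvgM; [exact: cvg_cst | exact: cvg_harmonic].
by rewrite mulr0.
Qed.

(** Fekete's argument: every [u p] bounds the upper limit, so the infimum over p >= 1 is the limit.
    Index 0 is left out because densities divide by zero there. *)
Lemma cvg_inf (R : realType) (u : nat -> R) :
  (forall m, 0 <= u m) ->
  (forall p, (0 < p)%N ->
    exists C, forall m, (0 < m)%N -> u m <= u p + C / m%:R) ->
  exists L, u @ \oo --> L /\ forall p, (0 < p)%N -> L <= u p.
Proof.
move=> u0 uC; pose S := [set u p | p in [set p | (0 < p)%N]].
have hS : has_inf S.
  by split; [exists (u 1%N); exists 1%N | exists 0 => _ [p _ <-]].
have infS p : (0 < p)%N -> inf S <= u p.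
  by move=> p0; apply: ge_inf; [exact: hS.2 | exists p].
exists (inf S); split => //.
apply/cvgrPdist_le => e e0.
have e20 : 0 < e / 2 by rewrite divr_gt0.
have [_ [p p0 <-] up] := inf_adherent e20 hS.
have [C Cp] := uC p p0.
have nearC : \forall m \near \oo, C / m%:R <= e / 2.
  exact: (@cvgr_le _ _ _ _ _ _ (cvg_div_nat C)).
near=> m; rewrite distrC ger0_norm.
  rewrite lerBlDl; apply: (le_trans (Cp m _)); first by near: m; exists 1%N.
  rewrite [e]splitr addrA; apply: lerD; first exact: ltW.
  by near: m.
by rewrite subr_ge0 infS//; near: m; exists 1%N.
Unshelve. all: by end_near.
Qed.

Section Density.
Variables (R : realType) (n : nat).
Hypothesis n0 : (0 < n)%N.

Definition density (U : nat -> set (multinom n)) (m : nat) : R :=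
  (cocard (U m))%:R / m%:R ^+ n.

Lemma exprn_pred (x : R) : x ^+ n = x * x ^+ n.-1.
Proof. by rewrite -exprS prednK. Qed.

Lemma cvg_density d U : graded_upsets d U ->
  exists L : R, density U @ \oo --> L /\
    forall p, (0 < p)%N -> L * p%:R ^+ n <= (cocard (U p))%:R.
Proof.
move=> gU.
have [| |L [cL LU]] := @cvg_inf R (density U).
- by move=> m; rewrite divr_ge0.
- move=> p p0; have [C UC] := graded_cocard_leq gU n0 p0.
  exists C%:R => m m0; have := UC m m0.
  rewrite -(ler_nat R) natrD !natrM !natrX => le.
  have pn : 0 < p%:R ^+ n :> R by rewrite exprn_gt0 ?ltr0n.
  have mn : 0 < m%:R ^+ n :> R by rewrite exprn_gt0 ?ltr0n.
  rewrite /density ler_pdivrMr// -(ler_pM2l pn); apply: le_trans le _.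
  have m1 : 0 < m%:R :> R by rewrite ltr0n.
  rewrite [leRHS](_ : _ = m%:R ^+ n * (cocard (U p))%:R +
    p%:R ^+ n * (C%:R * (m%:R ^+ n / m%:R))).
    by rewrite [X in X / m%:R]exprn_pred mulrAC divff ?mul1r ?gt_eqF.
  by field; rewrite !gt_eqF.
- exists L; split => // p p0; rewrite -ler_pdivlMr ?LU//.
  by rewrite exprn_gt0 ?ltr0n.
Qed.

(** With X the saturation, L (M k m)^n <= c(U_{Mkm}) <= M^n c(X_{km}), and c(X_{km}) <= c(k B) + n
    |w| k (d k m)^(n-1). Dividing by M^n and k^n leaves a bound free of [k]. *)
Lemma msumset_pow_lower_bound d U B w (L : R) m k :
  graded_upsets d U ->
  (forall p, (0 < p)%N -> L * p%:R ^+ n <= (cocard (U p))%:R) ->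
  (0 < m)%N -> (0 < k)%N -> upset B -> U m `<=` B ->
  (forall u, B u -> saturation U m (mnm_add u w)) ->
  L * m%:R ^+ n - (n * mdeg w * d ^ n.-1)%:R * m%:R ^+ n.-1
    <= density (msumset_pow B) k.
Proof.
move=> gU LU m0 k0 uB UB BX.
have km0 : (0 < k * m)%N by rewrite muln_gt0 k0.
have wom i : (w i <= mdeg w)%N by rewrite mdegE (bigD1 i)//= leq_addr.
have [M M0 cM] := cocard_saturation gU km0.
have := LU (M * (k * m))%N; rewrite muln_gt0 M0 km0 => /(_ isT) le1.
have le2 := cocard_saturation_msumset_pow gU k0 m0 wom UB uB BX.
have Mn : 0 < M%:R ^+ n :> R by rewrite exprn_gt0 ?ltr0n.
have kn : 0 < k%:R ^+ n :> R by rewrite exprn_gt0 ?ltr0n.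
have le3 : L * (k%:R * m%:R) ^+ n <= (cocard (saturation U (k * m)))%:R.
  rewrite -(ler_pM2l Mn); move: cM; rewrite -(ler_nat R) natrM natrX.
  apply: le_trans; apply: le_trans le1.
  by rewrite !natrM [leRHS](_ : _ = M%:R ^+ n * (L * (k%:R * m%:R) ^+ n))//
    exprMn; ring.
rewrite /density ler_pdivlMr// mulrBl lerBlDr.
move: le2; rewrite -(ler_nat R); move/(le_trans le3).
rewrite exprMn mulrA mulrAC => /le_trans; apply.
rewrite natrD lerD2l !natrM !natrX !natrM !exprMn.
by rewrite [k%:R ^+ n]exprn_pred le_eqVlt; apply/orP; left; apply/eqP; ring.
Qed.

(** If e_m is the limit density of the powers of [B m], then L - C/m <= e_m/m^n <= c(B_m)/m^n <=
    c(U_m)/m^n, and both ends tend to [L]. *)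
Lemma cvg_density_between d U B w (L : R) :
  graded_upsets d U -> density U @ \oo --> L ->
  (forall p, (0 < p)%N -> L * p%:R ^+ n <= (cocard (U p))%:R) ->
  (forall m, (0 < m)%N -> [/\ upset (B m), U m `<=` B m &
    forall u, B m u -> saturation U m (mnm_add u w)]) ->
  density B @ \oo --> L /\
  exists e : nat -> R,
    (forall m, (0 < m)%N -> density (msumset_pow (B m)) @ \oo --> e m) /\
    (fun m => e m / m%:R ^+ n) @ \oo --> L.
Proof.
move=> gU cU LU BU.
have /choice[e eP] : forall m, exists e : R, (0 < m)%N ->
    [/\ density (msumset_pow (B m)) @ \oo --> e, e <= (cocard (B m))%:R
      & L * m%:R ^+ n - (n * mdeg w * d ^ n.-1)%:R * m%:R ^+ n.-1 <= e].
  case=> [|m]; first by exists 0.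
  have [uB UB BX] := BU m.+1 isT.
  have B0 : B m.+1 !=set0.
    by have [_ g0 _ _] := gU; have [u Uu] := g0 m.+1; exists u; exact: UB.
  have Bd i : B m.+1 (mnm_muln (mnm1 i) (d * m.+1)).
    exact/UB/(graded_pow_var gU).
  have [e [ce eB]] := cvg_density (graded_msumset_pow uB B0 Bd).
  exists e => _; split=> //.
    (* The limit lies below every term of positive index; the term of index 1 is the colength of
       [B m.+1] itself. *)
    by have := eB 1%N isT; rewrite msumset_pow1// expr1n mulr1.
  apply: (@cvgr_to_ge _ _ _ _ _ _ _ ce).
  near=> k; apply: (msumset_pow_lower_bound gU) => //.
  by near: k; exists 1%N.
have bounds m : (0 < m)%N ->
    L - (n * mdeg w * d ^ n.-1)%:R / m%:R <= e m / m%:R ^+ n <= density B m /\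
    density B m <= density U m.
  move=> m0; have [_ eB Le] := eP m m0; have [_ UB _] := BU m m0.
  have mn : 0 < m%:R ^+ n :> R by rewrite exprn_gt0 ?ltr0n.
  have m1 : 0 < m%:R :> R by rewrite ltr0n.
  rewrite /density !ler_pM2r ?invr_gt0// eB ler_nat.
  split; last by apply: cocardS UB; exact: (graded_finite gU).
  rewrite andbT ler_pdivlMr//; apply: le_trans Le.
  by rewrite mulrBl exprn_pred [_ / _ * _]mulrA divfK ?gt_eqF.
have cL : (fun m : nat => L - (n * mdeg w * d ^ n.-1)%:R / m%:R) @ \oo --> L.
  rewrite -[X in _ --> X]subr0; apply: cvgB; first exact: cvg_cst.
  exact: cvg_div_nat.
split; [|exists e; split=> [m /eP[]//|]];
  apply: (squeeze_cvgr _ cL cU); near=> m;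
  have [|/andP[le1 le2] le3] := bounds m.
- by near: m; exists 1%N.
- by rewrite (le_trans le1 le2).
- by near: m; exists 1%N.
- by rewrite le1 (le_trans le2 le3).
Unshelve. all: by end_near.
Qed.

End Density.

(** * Monomial ideals and the local ring at the origin *)

Section Ideals.
Variable A : comNzRingType.
Implicit Types (I J S : set A).

Lemma ideal_sum I (T : Type) (r : seq T) (P : pred T) (F : T -> A) :
  is_ideal I -> (forall t, P t -> I (F t)) -> I (\sum_(t <- r | P t) F t).
Proof. by move=> [I0 ID IM] IF; apply: big_ind. Qed.

Lemma ideal_sum_seq I (T : eqType) (r : seq T) (F : T -> A) : is_ideal I ->
  (forall t, t \in r -> I (F t)) -> I (\sum_(t <- r) F t).
Proof. by move=> iI IF; rewrite big_seq; exact: ideal_sum. Qed.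

Lemma ideal_gen_ideal S : is_ideal (ideal_gen S).
Proof.
split=> [J [] []//|x y Sx Sy J SJ|r x Sx J SJ]; have [[_ JD JM] _] := SJ.
  by apply: JD; [exact: Sx | exact: Sy].
by apply: JM; exact: Sx.
Qed.

Lemma sub_ideal_gen S : S `<=` ideal_gen S.
Proof. exact: sub_smallest. Qed.

Lemma ideal_gen_sub S I : is_ideal I -> S `<=` I -> ideal_gen S `<=` I.
Proof. by move=> iI SI x; apply. Qed.

Lemma ideal_opp I x : is_ideal I -> I x -> I (- x).
Proof. by move=> [_ _ IM] Ix; rewrite -mulN1r; exact: IM. Qed.
End Ideals.

Section MonomialIdeals.
Variables (K : fieldType) (n : nat).
Implicit Types (f g h : mpoly n K) (U V : set (multinom n)).
Implicit Types (I : set (mpoly n K)).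

Definition msupp_in U : set (mpoly n K) := [set f | forall u, u \in msupp f -> U u].

Definition exponents I : set (multinom n) := [set u | I (mpolyX K u)].

Lemma msupp_in_ideal U : upset U -> is_ideal (msupp_in U).
Proof.
move=> uU; split=> [u|f g Uf Ug u|f g Ug u].
- by rewrite msupp0.
- by move/msuppD_le; rewrite mem_cat => /orP[/Uf|/Ug].
- move/msuppM_le/allpairsP => [[v w] /= [_ /Ug Uw ->]].
  exact: uU Uw (lem_addl _ _).
Qed.

Lemma msupp_in_mpolyX U u : msupp_in U (mpolyX K u) <-> U u.
Proof.
split=> [|Uu v]; first by apply; rewrite msuppX inE.
by rewrite msuppX inE => /eqP->.
Qed.

Lemma upset_exponents I : is_ideal I -> upset (exponents I).
Proof.
move=> [_ _ IM] u v Iu uv.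
by rewrite /exponents /= (lem_add_witness uv) mpolyXD; exact: IM.
Qed.

Lemma ideal_scale I (c : K) f : is_ideal I -> I f -> I (c *: f).
Proof. by move=> [_ _ IM] If; rewrite -mul_mpolyC; exact: IM. Qed.

Lemma monomial_span_sub V u : exponents (monomial_span V) u ->
  exists2 v, V v & lem v u.
Proof.
pose W := [set u | exists2 v, V v & lem v u].
have uW : upset W.
  by move=> x y [v Vv vx] xy; exists v => //; exact: lepm_trans vx xy.
have VW : monomial_span V `<=` msupp_in W.
  apply: ideal_gen_sub; first exact: msupp_in_ideal.
  by move=> _ [v Vv <-]; apply/msupp_in_mpolyX; exists v => //; exact: lepm_refl.
by move=> /VW /msupp_in_mpolyX.
Qed.

(** From here on a monomial ideal is handled through its exponents: the support of a polynomial
    decides membership. *)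
Lemma monomial_idealE I : monomial_ideal I -> I = msupp_in (exponents I).
Proof.
move=> [V ->]; have iI : is_ideal (@monomial_span K n V).
  by rewrite /monomial_span; exact: ideal_gen_ideal.
apply/seteqP; split=> [|f If].
  apply: ideal_gen_sub; first by apply: msupp_in_ideal; exact: upset_exponents.
  by move=> _ [v Vv <-]; apply/msupp_in_mpolyX; apply: sub_ideal_gen; exists v.
rewrite (mpolyE f); apply: (@ideal_sum_seq _ _ (multinom n) _ _ iI) => u /If Iu.
exact: (ideal_scale _ iI Iu).
Qed.

Lemma meval0E f : meval (fun=> 0) f = mcoeff (@mnm0 n) f.
Proof.
rewrite mevalE [in RHS](mpolyE f) raddf_sum /=; apply: eq_bigr => u _.
rewrite mcoeffZ mcoeffX; congr (_ * _); case: eqVneq => [->|u0].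
  by rewrite big1// => i _; rewrite mnm0E.
have [i ui] : exists i, u i != 0%N.
  apply/existsP; apply: contra_neqT u0 => /existsPn u0.
  by apply/mnmP => i; rewrite mnm0E; apply/eqP/negPn/u0.
by rewrite (bigD1 i)//= expr0n (negbTE ui) mul0r.
Qed.

End MonomialIdeals.

(** * Extension of monomial ideals to the local ring at the origin *)

Section OriginLocalRing.
Variables (K : fieldType) (n : nat).
Local Notation A := (origin_local_ring K n).
Local Notation loc := (@origin_loc K n).
Implicit Types (f g h : mpoly n K) (U V : set (multinom n)) (x y : A).

Definition local_msupp_in U : set A := [set x | exists f g,
  [/\ msupp_in U f, meval (fun=> 0) g != 0 & val x = tofrac f / tofrac g]].

Lemma origin_locD : {morph loc : f g / f + g}.
Proof. by move=> f g; apply: val_inj; rewrite rmorphD /= !rmorphD. Qed.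

Lemma origin_locM : {morph loc : f g / f * g}.
Proof. by move=> f g; apply: val_inj; rewrite rmorphM /= !rmorphM. Qed.

Lemma origin_loc0 : loc 0 = 0.
Proof. by apply: val_inj; rewrite rmorph0 /= rmorph0. Qed.

Lemma origin_loc1 : loc 1 = 1.
Proof. by apply: val_inj; rewrite rmorph1 /= rmorph1. Qed.

Lemma tofrac_neq0 g : meval (fun=> 0) g != 0 -> tofrac g != 0.
Proof. by apply: contra; rewrite tofrac_eq0 => /eqP ->; rewrite meval0. Qed.

Lemma origin_loc_fractionP x : exists f g,
  meval (fun=> 0) g != 0 /\ val x = tofrac f / tofrac g.
Proof. by case: x => x /= /asboolP. Qed.

Lemma origin_loc_invP g : meval (fun=> 0) g != 0 -> exists x, x * loc g = 1.
Proof.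
move=> g0; have gR : (tofrac g)^-1 \in @regular_at_origin K n.
  by apply/asboolP; exists 1, g; rewrite rmorph1 mul1r.
exists (OriginLocal gR); apply: val_inj; rewrite rmorphM rmorph1 /=.
by rewrite mulVf// tofrac_neq0.
Qed.

Lemma local_msupp_in_ideal U : upset U -> is_ideal (local_msupp_in U).
Proof.
move=> /(@msupp_in_ideal K)[U0 UD UM]; split.
- exists 0, 1; split => //; first by rewrite meval1 oner_eq0.
  by rewrite rmorph0 rmorph0 mul0r.
- move=> x y [f [g [Uf g0 xE]]] [f' [g' [Uf' g'0 yE]]].
  exists (f * g' + f' * g), (g * g'); split.
  + by apply: UD; rewrite mulrC; exact: UM.
  + by rewrite mevalM mulf_neq0.
  + by rewrite rmorphD /= xE yE addf_div ?tofrac_neq0// rmorphD !rmorphM.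
- move=> x y [f' [g' [Uf' g'0 yE]]].
  have [f [g [g0 xE]]] := origin_loc_fractionP x.
  exists (f * f'), (g * g'); split; first exact: UM.
    by rewrite mevalM mulf_neq0.
  by rewrite rmorphM /= xE yE mulf_div !rmorphM.
Qed.

Lemma local_msupp_in_loc U f : msupp_in U f -> local_msupp_in U (loc f).
Proof.
move=> Uf; exists f, 1; split => //; first by rewrite meval1 oner_eq0.
by rewrite /= rmorph1 divr1.
Qed.

(** A fraction f/g is the unit 1/g times a combination of the monomials of f, so testing monomials
    is enough. *)
Lemma local_msupp_in_sub U (J : set A) : is_ideal J ->
  (forall u, U u -> J (loc (mpolyX K u))) -> local_msupp_in U `<=` J.
Proof.
move=> iJ UJ x [f [g [Uf g0 xE]]]; have [_ JD JM] := iJ.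
have [y yg] := origin_loc_invP g0.
have -> : x = y * loc f.
  apply: val_inj; rewrite rmorphM /= xE mulrC; congr (_ * _).
  apply: (mulIf (tofrac_neq0 g0)); rewrite mulVf ?tofrac_neq0//.
  by have := congr1 val yg; rewrite rmorphM rmorph1.
apply: (JM); rewrite (mpolyE f) (big_morph loc origin_locD origin_loc0).
apply: (@ideal_sum_seq _ _ (multinom n) _ _ iJ) => u /Uf Uu.
by rewrite -mul_mpolyC origin_locM; apply: JM; exact: UJ.
Qed.

Lemma local_idealE U : upset U -> local_ideal (msupp_in U) = local_msupp_in U.
Proof.
move=> uU; apply/seteqP; split.
  apply: ideal_gen_sub; first exact: local_msupp_in_ideal.
  by move=> _ [f Uf <-]; exact: local_msupp_in_loc.
apply: local_msupp_in_sub; first exact: ideal_gen_ideal.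
move=> u Uu; apply: sub_ideal_gen; exists (mpolyX K u) => //.
exact/msupp_in_mpolyX.
Qed.

(** If X^u = f/g, then f = X^u g has the nonzero coefficient g(0) at [u], so [u] is in the support
    of f: localization adds no monomials. *)
Lemma local_msupp_in_mpolyX U u : local_msupp_in U (loc (mpolyX K u)) <-> U u.
Proof.
split=> [[f [g [Uf g0 /= /eqP]]]|Uu]; last first.
  exact/local_msupp_in_loc/msupp_in_mpolyX.
rewrite -(can2_eq (mulfK (tofrac_neq0 g0)) (divfK (tofrac_neq0 g0))).
rewrite -rmorphM tofrac_eq => /eqP fE; apply: Uf.
rewrite mcoeff_msupp -fE mulrC -[X in mcoeff X _]addm0.
by rewrite mcoeffMX -meval0E.
Qed.

Lemma local_msupp_in_setT : local_msupp_in setT = setT.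
Proof.
apply/seteqP; split => // x _.
by have [f [g [g0 xE]]] := origin_loc_fractionP x; exists f, g.
Qed.

Lemma ideal_pow_local_msupp_in U k : upset U ->
  ideal_pow (local_msupp_in U) k = local_msupp_in (msumset_pow U k).
Proof.
move=> uU; elim: k => [|k IH] /=; first by rewrite local_msupp_in_setT.
rewrite IH; apply/seteqP; split.
  apply: ideal_gen_sub.
    exact: local_msupp_in_ideal (@upset_msumset_pow _ U k.+1 uU).
  move=> _ [x [f [g [Uf g0 xE]]] [y [f' [g' [Uf' g'0 yE]]] <-]].
  exists (f * f'), (g * g'); split.
  - move=> _ /msuppM_le/allpairsP[[u v] /= [/Uf Uu /Uf' Uv ->]].
    by exists u => //; exists v.
  - by rewrite mevalM mulf_neq0.
  - by rewrite rmorphM /= xE yE mulf_div !rmorphM.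
apply: local_msupp_in_sub; first exact: ideal_gen_ideal.
move=> _ [u Uu [v Uv <-]]; rewrite mpolyXD origin_locM; apply: sub_ideal_gen.
exists (loc (mpolyX K u)); first exact/local_msupp_in_mpolyX.
by exists (loc (mpolyX K v)) => //; exact/local_msupp_in_mpolyX.
Qed.

End OriginLocalRing.

(** * Colength of local monomial ideals *)

Section Colength.
Variables (K : fieldType) (n : nat).
Local Notation A := (origin_local_ring K n).
Local Notation loc := (@origin_loc K n).
Implicit Types (f g h : mpoly n K) (U V : set (multinom n)) (x y : A).

Lemma origin_locB : {morph loc : f g / f - g}.
Proof. by move=> f g; apply: val_inj; rewrite rmorphB /= !rmorphB. Qed.

Definition origin_loc_const (c : K) : A := loc (mpolyC n c).

Lemma origin_loc_constD : {morph origin_loc_const : a b / a + b}.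
Proof. by move=> a b; rewrite /origin_loc_const mpolyCD origin_locD. Qed.

Lemma origin_loc_constM : {morph origin_loc_const : a b / a * b}.
Proof. by move=> a b; rewrite /origin_loc_const mpolyCM origin_locM. Qed.

Lemma origin_loc_const0 : origin_loc_const 0 = 0.
Proof. by rewrite /origin_loc_const mpolyC0 origin_loc0. Qed.

Lemma origin_loc_const1 : origin_loc_const 1 = 1.
Proof. by rewrite /origin_loc_const mpolyC1 origin_loc1. Qed.

Lemma mdeg_msuppX h N u : meval (fun=> 0) h = 0 -> u \in msupp (h ^+ N) ->
  (N <= mdeg u)%N.
Proof.
move=> h0; elim: N u => [//|N IH] u.
rewrite exprS => /msuppM_le/allpairsP[[v w] /= [hv /IH Nw ->]].
rewrite mdegD -add1n leq_add// lt0n mdeg_eq0.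
by apply: contraTneq hv => ->; rewrite mcoeff_msupp -meval0E h0 eqxx.
Qed.

Lemma finite_compl_mdeg U : finite_set (~` U) ->
  exists N, forall u, (N <= mdeg u)%N -> U u.
Proof.
move=> fU; exists (\max_(u <- fset_set (~` U)) mdeg u).+1 => u Nu.
apply: contrapT => Uu; move: Nu; rewrite ltnNge => /negP; apply.
by apply: (@leq_bigmax_seq _ _ xpredT) => //; apply/mem_fset_set.
Qed.

(* For [g(0) = 1] and [h = 1 - g], [1/g = 1 + h + ... + h^(N-1) + h^N / g],
   and [h^N] lies in the ideal for [N] large. *)
Lemma local_eq_poly U x : finite_set (~` U) -> upset U ->
  exists f, local_msupp_in U (x - loc f).
Proof.
move=> /finite_compl_mdeg[N UN] uU.
have [f [g [g0 xE]]] := origin_loc_fractionP x.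
have [_ _ IM] := @local_msupp_in_ideal K n U uU.
have xg : x * loc g = loc f.
  by apply: val_inj; rewrite rmorphM /= xE divfK ?tofrac_neq0.
pose c := meval (fun=> 0) g; pose h := 1 - c^-1 *: g.
have h0 : meval (fun=> 0) h = 0.
  by rewrite mevalB meval1 mevalZ mulVf ?subrr.
exists (f * (c^-1 *: \sum_(j < N) h ^+ j)).
have -> : x - loc (f * (c^-1 *: \sum_(j < N) h ^+ j)) = x * loc (h ^+ N).
  rewrite origin_locM -xg -mulrA -origin_locM -scalerAr scalerAl.
  have -> : c^-1 *: g = 1 - h by rewrite opprB addrC subrK.
  have -> : (1 - h) * (\sum_(j < N) h ^+ j) = 1 - h ^+ N.
    by rewrite -(opprB h) mulNr -subrX1 opprB.
  by rewrite -{1}[x]mulr1 -mulrBr -origin_loc1 -origin_locB opprB addrC subrK.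
by apply: IM; apply: local_msupp_in_loc => u /(mdeg_msuppX h0); exact: UN.
Qed.

Section Chain.
Variable U : set (multinom n).
Hypotheses (uU : upset U) (fU : finite_set (~` U)).
Let c := cocard U.
Let t (i : 'I_c) : multinom n := nth (@mnm0 n) (fset_set (~` U)) i.

Definition loc_comb (v : 'rV[K]_c) : A :=
  \sum_i origin_loc_const (v 0 i) * loc (mpolyX K (t i)).

Lemma loc_combD v w : loc_comb (v + w) = loc_comb v + loc_comb w.
Proof.
rewrite -big_split; apply: eq_bigr => i _.
by rewrite mxE origin_loc_constD mulrDl.
Qed.

Lemma loc_combZ a v : loc_comb (a *: v) = origin_loc_const a * loc_comb v.
Proof.
rewrite mulr_sumr; apply: eq_bigr => i _.
by rewrite mxE origin_loc_constM mulrA.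
Qed.

Lemma loc_comb0 : loc_comb 0 = 0.
Proof.
by rewrite /loc_comb big1// => i _; rewrite mxE origin_loc_const0 mul0r.
Qed.

(** The monomials outside [U] span the quotient over K: [local_eq_poly] gives a polynomial
    representative, whose terms with exponent in [U] are dropped. *)
Lemma local_eq_loc_comb x : exists v, local_msupp_in U (x - loc_comb v).
Proof.
have iU := @local_msupp_in_ideal K n U uU; have [I0 ID IM] := iU.
have [f xf] := local_eq_poly x fU uU.
suff [v fv] : exists v, local_msupp_in U (loc f - loc_comb v).
  by exists v; rewrite -(subrK (loc f) x) -addrA; exact: ID.
rewrite (mpolyE f); elim: (msupp f) => [|u s [v IH]].
  by exists 0; rewrite big_nil loc_comb0 origin_loc0 subrr.
rewrite big_cons.
have [w uw] : exists w,
    local_msupp_in U (loc (mcoeff u f *: mpolyX K u) - loc_comb w).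
  have [Uu|Uu] := pselect (U u).
    exists 0; rewrite loc_comb0 subr0; apply: local_msupp_in_loc.
    by apply: (ideal_scale _ (@msupp_in_ideal K n U uU)); exact/msupp_in_mpolyX.
  have us : u \in fset_set (~` U) by apply/mem_fset_set.
  have ic : (index u (fset_set (~` U)) < c)%N by rewrite index_mem.
  exists (\row_j (mcoeff u f *+ (j == Ordinal ic))).
  rewrite /loc_comb (bigD1 (Ordinal ic))//= mxE eqxx mulr1n big1 ?addr0.
    by rewrite /t /= nth_index// -origin_locM mul_mpolyC subrr.
  by move=> j jc; rewrite mxE (negbTE jc) mulr0n origin_loc_const0 mul0r.
exists (w + v); rewrite loc_combD origin_locD opprD addrACA; exact: ID.
Qed.

(** Choosing [v i] with [loc_comb (v i)] in [J i.+1] but not in [J i] gives [k] linearly independent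
    vectors of K^c. *)
Lemma quotient_chain_leq k : quotient_chain (local_msupp_in U : set A) k ->
  (k <= c)%N.
Proof.
move=> [J [J0 Jk iJ sJ]].
have J_mono i j : (i <= j)%N -> (j <= k)%N -> J i `<=` J j.
  move=> ij; elim: j ij => [|j IH]; first by rewrite leqn0 => /eqP-> _ x.
  rewrite leq_eqVlt => /orP[/eqP-> _ x //|ij jk].
  exact: subset_trans (IH ij (ltnW jk)) (sJ j jk).1.
have UJ i : (i <= k)%N -> local_msupp_in U `<=` J i.
  by move=> ik; rewrite -J0; exact: J_mono.
have /choice[v vP] : forall i : 'I_k, exists v,
    J i.+1 (loc_comb v) /\ ~ J i (loc_comb v).
  move=> i; have [_ /existsNP[x /not_implyP[Jx Jnx]]] := sJ i (ltn_ord i).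
  have [v xv] := local_eq_loc_comb x; exists v.
  have [_ JD _] := iJ i (ltnW (ltn_ord i)).
  have [_ JD' _] := iJ i.+1 (ltn_ord i).
  split.
    rewrite -(subKr x (loc_comb v)); apply: (JD') => //.
    apply: ideal_opp; first exact: iJ.
    by apply: UJ => //; exact: ltn_ord.
  move=> Jv; apply: Jnx; rewrite -(subrK (loc_comb v) x); apply: JD => //.
  by apply: UJ => //; exact/ltnW/ltn_ord.
pose M := \matrix_(i < k) v i.
suff : row_free M by move=> /eqP <-; exact: rank_leq_col.
apply: inj_row_free => a aM; apply: contrapT => /eqP a0.
have [i0 ai0] : exists i, a 0 i != 0.
  apply/existsP; apply: contra_neqT a0 => /existsPn a0.
  by apply/rowP => i; rewrite mxE; apply/eqP/negPn/a0.
(* In a linear relation, the last vector with nonzero coefficient is a combination of earlier ones,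
   whose images lie in [J i]; this contradicts its choice. *)
have [i ai imax] := @arg_maxnP _ i0 (fun i => a 0 i != 0) (@nat_of_ord k) ai0.
have [Jv nJv] := vP i; apply: nJv; have iJi := iJ i (ltnW (ltn_ord i)).
have [_ _ JM] := iJi.
have vi : loc_comb (a 0 i *: v i) =
    - \sum_(j < k | j != i) loc_comb (a 0 j *: v j).
  have : \sum_j loc_comb (a 0 j *: v j) = 0.
    have : loc_comb (a *m M) = 0 by rewrite aM loc_comb0.
    rewrite mulmx_sum_row (big_morph loc_comb loc_combD loc_comb0) => E.
    by rewrite -[RHS]E; apply: eq_bigr => j _; rewrite rowK.
  by rewrite (bigD1 i)//= => /eqP; rewrite addr_eq0 => /eqP.
have -> : loc_comb (v i) =
    origin_loc_const (a 0 i)^-1 * loc_comb (a 0 i *: v i).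
  by rewrite loc_combZ mulrA -origin_loc_constM mulVf// origin_loc_const1 mul1r.
apply: (JM); rewrite vi; apply: ideal_opp => //.
apply: ideal_sum => // j ji.
have [->|aj] := eqVneq (a 0 j) 0.
  by rewrite scale0r loc_comb0; case: iJi.
have ltji : (j < i)%N.
  by rewrite ltn_neqAle; have := imax j aj => /= ->; rewrite andbT.
rewrite loc_combZ; apply: JM.
exact: (J_mono j.+1 i ltji (ltnW (ltn_ord i)) _ (vP j).1).
Qed.

End Chain.

(** By induction on the number of missing points: adding a missing point [w] of maximal degree keeps
    the set up-closed, since anything strictly above [w] has larger degree, and the ideal grows
    strictly, as it gains X^w. *)
Lemma quotient_chain_cocard U : upset U -> finite_set (~` U) ->
  quotient_chain (local_msupp_in U : set A) (cocard U).
Proof.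
move: {2}(cocard U) (erefl (cocard U)) => c; elim: c U => [|c IH] U cU uU fU.
  have -> : U = setT.
    by rewrite -[LHS]setCK (fset_set_set0 fU (cardfs0_eq cU)) setC0.
  rewrite /cocard setCT fset_set0 cardfs0 local_msupp_in_setT.
  by exists (fun=> setT); split.
have [u0 Uu0] : exists u, u \in fset_set (~` U).
  by apply/fset0Pn; rewrite -cardfs_gt0 -/(cocard U) cU.
have [w Uw wmax] : exists2 w, ~ U w & forall u, ~ U u -> (mdeg u <= mdeg w)%N.
  pose r := fset_set (~` U).
  have [w _ wmax] :=
    @arg_maxnP _ [` Uu0]%fset xpredT (fun u : r => mdeg (val u)) isT.
  exists (val w); first by have /mem_fset_set := valP w; exact.
  move=> u Uu; have ur : u \in r by apply/mem_fset_set.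
  exact: wmax [` ur]%fset isT.
pose U' := U `|` [set w].
have uU' : upset U'.
  move=> u v [Uu|->] uv; first by left; exact: uU Uu uv.
  have [Uv|/wmax wv] := pselect (U v); [by left | right].
  move: wv; rewrite (lem_add_witness uv) mdegD -[leqRHS]add0n leq_add2r leqn0.
  by rewrite mdeg_eq0 => /eqP->; rewrite add0m.
have fU' : finite_set (~` U').
  by apply: sub_finite_set fU; apply: subsetC; exact: subsetUl.
have cU' : cocard U' = c.
  apply/eqP; rewrite -eqSS -cU /cocard setCU -setDE fset_setD1//.
  by rewrite [eqbRHS](cardfsD1 w) (_ : w \in _)//; apply/mem_fset_set.
have [J [J0 Jk iJ sJ]] := IH U' cU' uU' fU'.
rewrite cU -cU'; exists (fun i => if i is i'.+1 then J i' else local_msupp_in U).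
split=> //.
- by move=> [_|i ik]; [exact: local_msupp_in_ideal | exact: iJ].
- move=> [_|i ik]; last exact: sJ.
  rewrite J0; split.
    apply: local_msupp_in_sub; first exact: local_msupp_in_ideal.
    by move=> u Uu; apply/local_msupp_in_mpolyX; left.
  move=> U'U; apply: Uw; apply/(@local_msupp_in_mpolyX K)/U'U.
  by apply/local_msupp_in_mpolyX; right.
Qed.

Lemma colength_local_msupp_in (R : realType) U : upset U -> finite_set (~` U) ->
  colength R (local_msupp_in U : set A) = (cocard U)%:R%:E.
Proof.
move=> uU fU; apply/eqP; rewrite eq_le; apply/andP; split.
  apply: ge_ereal_sup => _ [k /(quotient_chain_leq uU fU) kc <-].
  by rewrite lee_fin ler_nat.
by apply: ereal_sup_ubound; exists (cocard U) => //;
  exact: quotient_chain_cocard.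
Qed.

End Colength.

(** * Convex hulls *)

Section ConvexHull.
Variables (R : realType) (n : nat).
Implicit Types (S : set 'rV[R]_n) (x y z : 'rV[R]_n).

Lemma convex_setP S : @convex_set R 'rV[R]_n S <->
  (forall x y (t : R), 0 <= t <= 1 -> S x -> S y -> S (t *: x + (1 - t) *: y)).
Proof.
split=> [cS x y t /andP[t0 t1] Sx Sy|cS x y t].
  by have := cS x y (Itv01 t0 t1); rewrite !inE; apply.
rewrite !inE => Sx Sy; apply: cS => //.
by apply/andP; split; [exact: ge0 | exact: le1].
Qed.

Lemma convex_hull_sub S C :
  (forall x y (t : R), 0 <= t <= 1 -> C x -> C y ->
    C (t *: x + (1 - t) *: y)) ->
  S `<=` C -> convex_hull S `<=` C.
Proof. by move=> /convex_setP cC SC x; apply. Qed.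

Lemma sub_convex_hull S : S `<=` convex_hull S.
Proof. exact: sub_smallest. Qed.

Lemma convex_hull_conv S x y (t : R) : 0 <= t <= 1 ->
  convex_hull S x -> convex_hull S y -> convex_hull S (t *: x + (1 - t) *: y).
Proof.
move=> t01 Sx Sy C CS; have [/convex_setP cC _] := CS.
by apply: cC => //; [exact: Sx | exact: Sy].
Qed.

(** Induction on the number of coordinates that may fail to be integers: such a coordinate is a
    convex combination of the integers u_i and u_i + N for N large, the others being kept. *)
Lemma upset_convex_hull (U : set (multinom n)) u z : upset U -> U u ->
  (forall i, (u i)%:R <= z 0 i) ->
  convex_hull [set exponent_point R u | u in U] z.
Proof.
move=> uU Uu.
(* Only coordinates of index below [j] may be non-integral; for j = 0 the point is itself an
   exponent of [U]. *)
suff H j : forall z, (forall i, (u i)%:R <= z 0 i) ->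
    (forall i : 'I_n, (j <= i)%N -> exists k : nat, z 0 i = k%:R) ->
    convex_hull [set exponent_point R u | u in U] z.
  by move=> uz; apply: (H n) => // i; rewrite leqNgt ltn_ord.
elim: j => [|j IH] {}z uz zint.
  have /choice[k kz] := fun i => zint i (leq0n i).
  apply: sub_convex_hull; exists (Multinom [tuple k i | i < n]).
    apply: uU Uu _; apply/mnm_lepP => i; rewrite mnmE -(ler_nat R) -kz.
    exact: uz.
  by apply/rowP => i; rewrite mxE mnmE kz.
have [nj|jn] := leqP n j.
  by apply: IH => // i; rewrite leqNgt (leq_trans (ltn_ord i) nj).
pose i0 := Ordinal jn; pose N := (Num.truncn (z 0 i0 - (u i0)%:R)).+1.
have N0 : 0 < N%:R :> R by rewrite ltr0n.
have zN : z 0 i0 - (u i0)%:R < N%:R by exact: truncnS_gt.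
pose w (c : nat) : 'rV[R]_n := \row_i if i == i0 then (u i0 + c)%:R else z 0 i.
have hw c : convex_hull [set exponent_point R u | u in U] (w c).
  apply: IH => [i|i ji]; rewrite mxE; case: eqVneq => [ii0|ii0].
  - by rewrite ii0 ler_nat leq_addr.
  - exact: uz.
  - by exists (u i0 + c)%N.
  - by apply: zint; rewrite ltn_neqAle eq_sym ji andbT.
pose t := (z 0 i0 - (u i0)%:R) / N%:R.
have -> : z = t *: w N + (1 - t) *: w 0%N.
  apply/rowP => i; rewrite !mxE; case: eqVneq => [->|_]; last by ring.
  by rewrite addn0 natrD /t; field; rewrite gt_eqF.
apply: convex_hull_conv => //; apply/andP; split.
  by rewrite divr_ge0// subr_ge0.
by rewrite ler_pdivrMr// mul1r ltW.
Qed.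

End ConvexHull.

(** * Rational approximation of points of the convex hull *)

Section NearHull.
Variables (R : realType) (n d : nat) (U : nat -> set (multinom n)).
Hypothesis gU : graded_upsets d U.

(** Raising [y] by any positive [e] makes it dominate some v/M with v in [U (M * p)]. The set is
    convex and contains the exponent points of [U p], hence their hull; no explicit finite
    combinations are needed. *)
Definition near_hull (p : nat) : set 'rV[R]_n := [set y |
  forall e, 0 < e -> exists M v, [/\ (0 < M)%N, U (M * p)%N v &
    forall i, (v i)%:R <= M%:R * (y 0 i + e)]].

(* [t] is approximated by [(s + 1) / (N + 2)] with [s = floor (t N)], rather than
   [s / N], to keep both weights positive. *)
Lemma near_hull_conv p y z (t : R) : 0 <= t <= 1 ->
  near_hull p y -> near_hull p z -> near_hull p (t *: y + (1 - t) *: z).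
Proof.
move=> /andP[t0 t1] Hy Hz e e0; have e20 : 0 < e / 2 by lra.
have [M1 [v1 [M10 U1 v1y]]] := Hy _ e20.
have [M2 [v2 [M20 U2 v2z]]] := Hz _ e20.
pose D := \sum_i `|y 0 i - z 0 i|.
have D0 : 0 <= D by apply: sumr_ge0.
have yzD i : `|y 0 i - z 0 i| <= D.
  by rewrite /D (bigD1 i)//= lerDl sumr_ge0.
pose N := (Num.truncn (4 * D / e)).+1.
have ND : 4 * D <= N%:R * e.
  by rewrite -ler_pdivrMr// ltW// truncnS_gt.
have N0 : 0 < N%:R :> R by rewrite ltr0n.
pose s := Num.truncn (t * N%:R).
have /andP[s1 s2] : s%:R <= t * N%:R < s.+1%:R.
  by apply: truncn_itv; rewrite mulr_ge0.
have sN : (s <= N)%N.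
  by rewrite -(ler_nat R); apply: le_trans s1 _; rewrite ler_piMl// ltW.
pose r := (N - s)%N; have rE : r%:R = N%:R - s%:R :> R by rewrite natrB.
exists ((s + r + 2) * (M1 * M2))%N.
exists (mnm_add (mnm_muln (mnm_muln v1 M2) s.+1)
  (mnm_muln (mnm_muln v2 M1) r.+1)).
split.
- by rewrite !muln_gt0 M10 M20 addn2.
- have [_ _ gD _] := gU.
  have := gD _ _ _ _ (graded_muln gU (ltn0Sn s) (graded_muln gU M20 U1))
                     (graded_muln gU (ltn0Sn r) (graded_muln gU M10 U2)).
  by congr (U _ _); lia.
- move=> i; rewrite mnmDE !mulmnE !mxE natrD !natrM.
  have := v1y i; have := v2z i; move: (v1 i)%:R (v2 i)%:R => a b.
  move=> bz ay.
  have M1p : 0 < M1%:R :> R by rewrite ltr0n.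
  have M2p : 0 < M2%:R :> R by rewrite ltr0n.
  have : a * M2%:R * s.+1%:R + b * M1%:R * r.+1%:R <=
     (M1%:R * M2%:R) * (s.+1%:R * (y 0 i + e / 2) + r.+1%:R * (z 0 i + e / 2)).
    rewrite mulrDr; apply: lerD.
      rewrite [leRHS](_ : _ = (M1%:R * (y 0 i + e / 2)) * M2%:R * s.+1%:R);
        last by ring.
      by rewrite !ler_pM2r ?ltr0n.
    rewrite [leRHS](_ : _ = (M2%:R * (z 0 i + e / 2)) * M1%:R * r.+1%:R);
      last by ring.
    by rewrite !ler_pM2r ?ltr0n.
  move=> /le_trans; apply.
  rewrite [_%:R * (M1%:R * _)]mulrC -[leRHS]mulrA ler_pM2l ?mulr_gt0//.
  rewrite !natrD -[s.+1]addn1 -[r.+1]addn1 !natrD rE.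
  have := yzD i; move: s1 s2 ND; rewrite -[s.+1]addn1 natrD.
  move: (s%:R : R) (N%:R : R) N0 (y 0 i) (z 0 i) => S NN N0' Y Z s1 s2 ND yz.
  suff : (S + 1 - t * (NN + 2)) * (Y - Z) <= (NN + 2) * (e / 2) by lra.
  apply: le_trans (ler_norm _) _; rewrite normrM.
  have h1 : `|S + 1 - t * (NN + 2)| <= 2.
    by rewrite ler_norml; apply/andP; split; lra.
  apply: le_trans (ler_pM _ _ h1 yz) _ => //; lra.
Qed.

End NearHull.

(** * Multiplier ideals *)

Section Multiplier.
Variables (R : realType) (K : fieldType) (n d : nat).
Variable a : nat -> set (mpoly n K).
Let U p := exponents (a p).
Hypothesis gU : graded_upsets d U.
Local Notation multiplier m p := (multiplier_ideal R (m%:R / p%:R) (a p)).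

(** One unit comes from the vector (1, ..., 1) in the definition of multiplier ideals, the other
    absorbs the error [e] of [near_hull]. *)
Let two : multinom n := Multinom [tuple 2 | i < n].

Lemma ratr_div_nat m p : ratr (m%:R / p%:R) = m%:R / p%:R :> R.
Proof. by rewrite fmorph_div /= !ratr_nat. Qed.

Lemma multiplier_ideal_is_ideal lam I :
  is_ideal (@multiplier_ideal R K n lam I).
Proof. by rewrite /multiplier_ideal /monomial_span; exact: ideal_gen_ideal. Qed.

Lemma monomial_multiplier_ideal lam I :
  monomial_ideal (@multiplier_ideal R K n lam I).
Proof. by eexists. Qed.

(** With p = m the factor is 1, and the open unit ball of the sup norm around u + (1, ..., 1) lies
    in the orthant above u, which the Newton polyhedron contains. *)
Lemma sub_multiplier_ideal m : (0 < m)%N -> U m `<=` exponents (multiplier m m).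
Proof.
move=> m0 u Uu; apply: sub_ideal_gen; exists u => //=.
rewrite ratr_div_nat divff ?pnatr_eq0 -?lt0n//.
apply/nbhs_ballP; exists 1 => //= z [_ uz]; exists z; last by rewrite scale1r.
have [gu _ _ _] := gU; apply: upset_convex_hull (gu m) Uu _ => i.
have := uz ord0 i; rewrite /ball /= !mxE ltr_norml => /andP[_]; lra.
Qed.

(** Multiplication by [q] maps the Newton polyhedron of a_p into that of a_{qp}. Hence two members
    of the family have an upper bound at a common multiple of their indices. *)
Lemma multiplier_ideal_sub m p q : (0 < p)%N -> (0 < q)%N ->
  multiplier m p `<=` multiplier m (q * p)%N.
Proof.
move=> p0 q0; apply: ideal_gen_sub; first exact: multiplier_ideal_is_ideal.
move=> _ [u + <-] /=; rewrite ratr_div_nat => up.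
apply: sub_ideal_gen; exists u => //=; rewrite ratr_div_nat.
move: up; apply: interiorS => _ [x xP <-].
exists (q%:R *: x); last first.
  rewrite scalerA natrM; congr (_ *: _).
  by field; rewrite !pnatr_eq0 -!lt0n p0 q0.
move: x xP; apply: convex_hull_sub.
  move=> x y t t01 Px Py; rewrite scalerDr !scalerA ![q%:R * _]mulrC -!scalerA.
  exact: convex_hull_conv.
move=> _ [u' Uu' <-]; apply: sub_convex_hull.
exists (mnm_muln u' q); first exact: (graded_muln gU q0 Uu').
by apply/rowP => i; rewrite !mxE mulmnE natrM mulrC.
Qed.

(** The point x = (p/m)(v + (1, ..., 1)) lies in the Newton polyhedron of a_p, hence in
    [near_hull U p]. *)
Lemma multiplier_ideal_saturation m p u : (0 < m)%N -> (0 < p)%N ->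
  exponents (multiplier m p) u -> saturation U m (mnm_add u two).
Proof.
move=> m0 p0 /monomial_span_sub[v + vu]; rewrite /= ratr_div_nat.
move=> /interior_subset[x xP xv].
apply: (upset_saturation gU (u := mnm_add v two)); last first.
  apply/mnm_lepP => i; rewrite !mnmDE leq_add2r.
  exact: (mnm_lepP vu).
have {xP} : near_hull U p x.
  move: x xP xv => x xP _; move: x xP; apply: convex_hull_sub.
    exact: (near_hull_conv gU).
  move=> _ [w Uw <-] e e0; exists 1%N, w; split; rewrite ?mul1n// => i.
  by rewrite mul1r mxE lerDl ltW.
(* With e = p/m one gets w <= M (p/m)(v + (2, ..., 2)), so m w, a point of U_{mMp}, lies below M p
   (v + (2, ..., 2)). *)
have pm0 : 0 < p%:R / m%:R :> R by rewrite divr_gt0 ?ltr0n.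
move=> /(_ _ pm0)[M [w [M0 Uw wx]]].
exists (M * p)%N; first by rewrite muln_gt0 M0.
have [gu _ _ _] := gU.
have := graded_muln gU m0 Uw; rewrite mulnC => Umw.
apply: gu Umw _; apply/mnm_lepP => i; rewrite !mulmnE mnmDE mnmE.
have /rowP/(_ i) := xv; rewrite !mxE => xvi.
have m0R : 0 < m%:R :> R by rewrite ltr0n.
have p0R : 0 < p%:R :> R by rewrite ltr0n.
rewrite -(ler_nat R) !natrM !natrD.
apply: (@le_trans _ _ (M%:R * (x 0 i + p%:R / m%:R) * m%:R)).
  by rewrite ler_pM2r// wx.
have -> : x 0 i = p%:R / m%:R * ((v i)%:R + 1).
  by rewrite -xvi; field; rewrite !gt_eqF.
by rewrite le_eqVlt; apply/orP; left; apply/eqP; field; rewrite gt_eqF.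
Qed.

Lemma eq_of_cocard (V W : set (multinom n)) : finite_set (~` V) -> V `<=` W ->
  (cocard V <= cocard W)%N -> V = W.
Proof.
move=> fV VW cVW; apply: (can_inj setCK); apply/esym.
have fW : finite_set (~` W) by apply: sub_finite_set fV; exact: subsetC.
apply: fset_set_inj => //; apply/eqP; rewrite eqEfcard; apply/andP; split=> //.
by rewrite -fset_set_sub//; exact: subsetC.
Qed.

(** A non-maximal member containing [multiplier m m] is strictly contained in another one, of
    smaller finite colength, so a maximal member exists. By maximality the chosen one equals the
    member of index m p, which contains [multiplier m m]. *)
Lemma asymptotic_multiplier_idealP m : (0 < m)%N ->
  exists p, [/\ (0 < p)%N,
    asymptotic_multiplier_ideal R m%:R a = multiplier m p &
    multiplier m m `<=` multiplier m p].
Proof.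
move=> m0; pose maximal J := multiplier_family R m%:R a J /\
  forall J', multiplier_family R m%:R a J' -> J `<=` J' -> J' = J.
suff H c : forall p, (0 < p)%N -> multiplier m m `<=` multiplier m p ->
    (cocard (exponents (multiplier m p)) < c)%N -> exists J, maximal J.
  have [J Jmax] := H _ _ m0 (@subset_refl _ _) (ltnSn _).
  have [[p p0 pE] bmax] : maximal (asymptotic_multiplier_ideal R m%:R a).
    (* Since a maximal member exists, [xget] returns one rather than the default [setT]. *)
    exact: (xgetPex _ (ex_intro _ J Jmax)).
  have fam : multiplier_family R m%:R a (multiplier m (m * p)%N).
    by exists (m * p)%N => //=; rewrite muln_gt0 m0.
  have sub : asymptotic_multiplier_ideal R m%:R a `<=` multiplier m (m * p)%N.
    by rewrite -pE; exact: multiplier_ideal_sub.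
  exists p; split; [exact: p0 | exact/esym/pE |].
  rewrite [X in _ `<=` X]pE -(bmax _ fam sub) mulnC.
  exact: multiplier_ideal_sub.
elim: c => // c IH p p0 mp cp.
have [pmax|] := pselect (maximal (multiplier m p)).
  by eexists; exact: pmax.
move=> /not_andP[[]|]; first by exists p.
move=> /existsNP[_ /not_implyP[[q q0 <-]]] /not_implyP[pq qp].
apply: (IH q q0 (subset_trans mp pq)).
have fin : finite_set (~` exponents (multiplier m p)).
  apply: sub_finite_set (graded_finite gU m0); apply: subsetC.
  exact: subset_trans (sub_multiplier_ideal m0) (fun u => @mp _).
rewrite ltnNge; apply/negP => cq; apply: qp.
rewrite (monomial_idealE (monomial_multiplier_ideal _ (a q))).
rewrite (monomial_idealE (monomial_multiplier_ideal _ (a p))).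
congr msupp_in; apply/esym/eq_of_cocard => //.
  by move=> u; exact: pq.
by rewrite ltnS in cp; exact: leq_trans cp cq.
Qed.

(** These are the only properties of b_m that enter the counting argument. *)
Lemma asymptotic_multiplier_ideals_between m : (0 < m)%N ->
  let B := exponents (asymptotic_multiplier_ideals R a m) in
  [/\ upset B, U m `<=` B, forall u, B u -> saturation U m (mnm_add u two) &
    asymptotic_multiplier_ideals R a m = msupp_in B].
Proof.
move=> m0 /=; rewrite /asymptotic_multiplier_ideals.
have [p [p0 -> mp]] := asymptotic_multiplier_idealP m0; split.
- by apply: upset_exponents; exact: multiplier_ideal_is_ideal.
- by move=> u Uu; apply: mp; exact: sub_multiplier_ideal Uu.
- by move=> u; exact: (multiplier_ideal_saturation m0 p0).
- exact/monomial_idealE/monomial_multiplier_ideal.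
Qed.

End Multiplier.

(** * Volumes and multiplicities *)

Section Volume.
Variables (R : realType) (K : fieldType) (n : nat).
Hypothesis n0 : (0 < n)%N.

Lemma asymptotic_volume_density (c : nat -> set (mpoly n K))
    (W : nat -> set (multinom n)) (L : R) :
  (forall m, (0 < m)%N ->
    [/\ upset (W m), finite_set (~` W m) & c m = msupp_in (W m)]) ->
  density R W @ \oo --> L -> asymptotic_volume R c = (n`!%:R * L)%:E.
Proof.
move=> cW cL; rewrite /asymptotic_volume.
set u := (u in limn_esup u).
suff /cvg_limn_einf_sup[] : u @ \oo --> (n`!%:R * L)%:E by [].
apply: cvg_trans (_ : (fun m => (n`!%:R * density R W m)%:E) @ \oo --> _).
  apply: near_eq_cvg; near=> m; have [|uW fW cE] := cW m.
    by near: m; exists 1%N.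
  rewrite /u cE local_idealE// colength_local_msupp_in// -EFinM /density.
  by rewrite mulrAC mulrA.
apply: cvg_EFin; first by near=> m.
by apply: cvgM => //; exact: cvg_cst.
Unshelve. all: by end_near.
Qed.

Lemma hs_multiplicity_msupp_in (W : set (multinom n)) (e : R) :
  upset W -> (forall k, finite_set (~` msumset_pow W k)) ->
  density R (msumset_pow W) @ \oo --> e ->
  hs_multiplicity R n (local_ideal (@msupp_in K n W)) = (n`!%:R * e)%:E.
Proof.
move=> uW fW ce; apply/cvg_lim => //.
rewrite [X in X @ _ --> _](_ : _ = fun k =>
    (n`!%:R * density R (msumset_pow W) k)%:E).
  apply: cvg_EFin; first by near=> m.
  by apply: cvgM => //; exact: cvg_cst.
apply/funext => k; rewrite local_idealE// ideal_pow_local_msupp_in//.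
rewrite colength_local_msupp_in//; last exact: upset_msumset_pow.
by rewrite -EFinM /density mulrAC mulrA.
Unshelve. all: by end_near.
Qed.

Lemma cvg_multiplicity_seq (c : nat -> set (mpoly n K))
    (W : nat -> set (multinom n)) (e : nat -> R) (L : R) :
  (forall m, (0 < m)%N ->
    [/\ upset (W m), forall k, finite_set (~` msumset_pow (W m) k),
      c m = msupp_in (W m) & density R (msumset_pow (W m)) @ \oo --> e m]) ->
  (fun m => e m / m%:R ^+ n) @ \oo --> L ->
  multiplicity_seq R c @ \oo --> (n`!%:R * L)%:E.
Proof.
move=> cW cL.
apply: cvg_trans (_ : (fun m => (n`!%:R * (e m / m%:R ^+ n))%:E) @ \oo --> _).
  apply: near_eq_cvg; near=> m; have [|uW fW cE ce] := cW m.
    by near: m; exists 1%N.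
  rewrite /multiplicity_seq cE (hs_multiplicity_msupp_in uW fW ce) -EFinM.
  by rewrite [_^-1 * _]mulrC mulrA.
apply: cvg_EFin; first by near=> m.
by apply: cvgM => //; exact: cvg_cst.
Unshelve. all: by end_near.
Qed.

Lemma ideal_pow_origin i k :
  ideal_pow (@origin_ideal K n) k (mpolyX K (mnm_muln (mnm1 i) k)).
Proof.
elim: k => [|k IH] //=; rewrite mulmS mpolyXD; apply: sub_ideal_gen.
exists (mpolyX K (mnm1 i)); first by apply: sub_ideal_gen; exists i.
by exists (mpolyX K (mnm_muln (mnm1 i) k)).
Qed.

Lemma graded_exponents (a : nat -> set (mpoly n K)) : graded_sequence a ->
  (forall m, supported_at_origin (a m)) ->
  exists d, graded_upsets d (fun m => exponents (a m)).
Proof.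
move=> [a_ideal aM] a_supp; have [_ [d a1]] := a_supp 1%N.
exists d; split.
- by move=> p; exact: upset_exponents.
- move=> p; have [_ [k ap]] := a_supp p.
  by exists (mnm_muln (mnm1 (Ordinal n0)) k); exact/ap/ideal_pow_origin.
- move=> p q u v au av; apply: aM; rewrite mpolyXD; apply: sub_ideal_gen.
  by exists (mpolyX K u) => //; exists (mpolyX K v).
- by move=> i; exact/a1/ideal_pow_origin.
Qed.

End Volume.

Unset Implicit Arguments.
Set Strict Implicit.

Theorem theorem2p12 (R : realType) (K : fieldType) (n : nat) (hn : (0 < n)%N)
    (a : nat -> set (mpoly n K))
    (a_graded : graded_sequence a)
    (a_monomial : forall m, monomial_ideal (a m))
    (a_zerodim : forall m, zero_dimensional_ideal (a m))
    (a_supported : forall m, supported_at_origin (a m)) :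
  let b := asymptotic_multiplier_ideals R a in
  [/\ cvgn (multiplicity_seq R b), cvgn (multiplicity_seq R a),
      asymptotic_multiplicity R b = asymptotic_volume R b,
      asymptotic_volume R b = asymptotic_volume R a
    & asymptotic_volume R a = asymptotic_multiplicity R a].
Proof.
move=> b; have [d gU] := graded_exponents hn a_graded a_supported.
have [gu _ _ _] := gU; set U := fun m => exponents (a m) in gU gu.
have [L [cU LU]] := @cvg_density R n hn d U gU.
(* One statement covers both sequences: if the exponents of [c m] contain [U m] and their shift by
   [w] lies in the saturation, then multiplicity and volume are n! L. It is applied to [b] with
   shift (2, ..., 2) and to [a] with shift 0. *)
have main (w : multinom n) (c : nat -> set (mpoly n K)) :
    (forall m, (0 < m)%N -> let B := exponents (c m) in
      [/\ upset B, U m `<=` B, forall u, B u -> saturation U m (mnm_add u w)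
        & c m = msupp_in B]) ->
    multiplicity_seq R c @ \oo --> (n`!%:R * L)%:E /\
    asymptotic_volume R c = (n`!%:R * L)%:E.
  move=> cP; pose B m := exponents (c m).
  have fin m k : (0 < m)%N -> finite_set (~` msumset_pow (B m) k).
    move=> m0; have [_ UB _ _] := cP m m0.
    case: k => [|k]; first by rewrite /= setCT.
    apply: sub_finite_set (graded_finite (graded_pow_msumset gU m0) (ltn0Sn k)).
    exact/subsetC/msumset_powS.
  have [|cB [e [ce eL]]] := @cvg_density_between R n hn d U B w L gU cU LU.
    by move=> m m0; have [] := cP m m0.
  split.
    apply: (cvg_multiplicity_seq (W := B) _ eL) => m m0.
    by have [uB _ _ cE] := cP m m0; split=> // [k|]; [exact: fin | exact: ce].
  apply: (asymptotic_volume_density _ cB) => m m0; have [uB _ _ cE] := cP m m0.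
  by split=> //; have := fin m 1%N m0; rewrite msumset_pow1.
have [cb vb] := main _ b
  (fun m m0 => asymptotic_multiplier_ideals_between R gU m0).
have [|ca va] := main (@mnm0 n) a.
  move=> m m0; split=> //.
    by move=> u Uu; rewrite addm0; exact: sub_saturation.
  exact: monomial_idealE.
split.
- by apply/cvg_ex; eexists; exact: cb.
- by apply/cvg_ex; eexists; exact: ca.
- by rewrite vb; exact/cvg_lim/cb.
- by rewrite vb va.
- by rewrite va; apply/esym; exact/cvg_lim/ca.
Qed.
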